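(* The real Banach space $\ell_1$ has the $1$-Schur property, i.e., for every bounded sequence $(x_k)_{k\in\mathbb N}$ in $\ell_1$, $$\operatorname{ca}(x_k)=\delta(x_k).$$
   Context: $\ell_1$ is the space of absolutely summable real sequences with its usual norm. All Banach spaces are real, and a Banach space $X$ is regarded as a subspace of its bidual $X^{**}$ via the canonical embedding. For a bounded sequence $(x_k)$ in a Banach space $X$: - $\operatorname{clust}_{X^{**}}(x_k)$ is the set of all weak* cluster points of $(x_k)$ in $X^{**}$; - $\delta(x_k)$ is the (norm) diameter of $\operatorname{clust}_{X^{**}}(x_k)$; - $\operatorname{ca}(x_k)=\inf_{n\in\mathbb N}\operatorname{diam}\{x_k: k\ge n\}$. For $C\ge 0$, $X$ has the $C$-Schur property if $\operatorname{ca}(x_k)\le C\,\delta(x_k)$ for each bounded sequence $(x_k)$ in $X$. *)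

(* Defs.v *)
From HB Require Import structures.
From mathcomp Require Import all_boot all_order all_algebra.
From mathcomp Require Import all_classical all_reals all_analysis.

Set Implicit Arguments.
Unset Strict Implicit.
Unset Printing Implicit Defensive.

Import Order.TTheory GRing.Theory Num.Theory.
Import numFieldNormedType.Exports.

Local Open Scope classical_set_scope.
Local Open Scope ring_scope.

Section Ell1.
Context {R : realType}.
Implicit Types (u : nat -> R).

Definition abs_summable : {pred nat -> R} :=
  fun u => `[< cvgn [normed series u] >].

Lemma normed_series_nd u : nondecreasing_seq [normed series u].
Proof. by apply: nondecreasing_series => n _ _; exact: normr_ge0. Qed.

Lemma normed_seriesE u n :
  [normed series u] n = \sum_(0 <= k < n) `|u k|.
Proof. by []. Qed.

Lemma abs_summableP u :
  reflect (exists M, forall n, [normed series u] n <= M) (u \in abs_summable).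
Proof.
apply: (iffP idP) => [|[M uM]].
  move/asboolP => cu; exists (limn [normed series u]) => n.
  exact: nondecreasing_cvgn_le (normed_series_nd u) cu n.
apply/asboolP; apply: nondecreasing_is_cvgn; first exact: normed_series_nd.
by exists M => _ [n _ <-]; exact: uM.
Qed.

Lemma normed_seriesD u v n :
  [normed series (u + v)] n <= [normed series u] n + [normed series v] n.
Proof.
by rewrite !normed_seriesE -big_split; apply: ler_sum => i _; exact: ler_normD.
Qed.

Lemma normed_seriesZ (a : R) u n :
  [normed series (a *: u)] n = `|a| * [normed series u] n.
Proof.
by rewrite !normed_seriesE mulr_sumr; apply: eq_bigr => i _; rewrite -normrM.
Qed.

Lemma abs_summable_submod : submod_closed abs_summable.
Proof.
split=> [|a u v /abs_summableP[M uM] /abs_summableP[N vN]].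
  apply/abs_summableP; exists 0 => n.
  by rewrite normed_seriesE big1// => i _; rewrite normr0.
apply/abs_summableP; exists (`|a| * M + N) => n.
rewrite (le_trans (normed_seriesD _ _ _))// normed_seriesZ lerD//.
by rewrite ler_wpM2l.
Qed.

HB.instance Definition _ :=
  GRing.isSubmodClosed.Build R (nat -> R) abs_summable abs_summable_submod.

End Ell1.

Record ell1 (R : realType) :=
  Ell1 { ell1_seq :> nat -> R ; _ : ell1_seq \in abs_summable }.

HB.instance Definition _ (R : realType) := [isSub for @ell1_seq R].
HB.instance Definition _ (R : realType) := [Choice of ell1 R by <:].
HB.instance Definition _ (R : realType) :=
  [SubChoice_isSubLmodule of ell1 R by <:].

Section Ell1Norm.
Context {R : realType}.
Implicit Types (x y : ell1 R).

Definition ell1_norm x : R := limn [normed series x].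

Lemma ell1_cvg x : cvgn [normed series x].
Proof. by have /asboolP := valP x. Qed.

Lemma ell1_norm_ge x n : [normed series x] n <= ell1_norm x.
Proof.
exact: nondecreasing_cvgn_le (normed_series_nd x) (@ell1_cvg x) n.
Qed.

Lemma ell1_norm_le x (M : R) :
  (forall n, [normed series x] n <= M) -> ell1_norm x <= M.
Proof. by move=> xM; apply: limr_le; [exact: ell1_cvg|exact: nearW]. Qed.

Lemma ell1_normD x y : ell1_norm (x + y) <= ell1_norm x + ell1_norm y.
Proof.
apply: ell1_norm_le => n.
by rewrite (le_trans (normed_seriesD _ _ _))// lerD// ell1_norm_ge.
Qed.

Lemma ell1_normZ (a : R) x : ell1_norm (a *: x) = `|a| * ell1_norm x.
Proof.
have -> : ell1_norm (a *: x) = limn (fun n => `|a| * [normed series x] n).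
  rewrite /ell1_norm; congr (limn _).
  by apply/funext => n; exact: normed_seriesZ.
apply: (@cvg_lim _ (@Rhausdorff R)); apply: cvgMl_tmp; exact: (@ell1_cvg x).
Qed.

Lemma ell1_coord_le x n : `|x n| <= ell1_norm x.
Proof.
apply: le_trans (ell1_norm_ge x n.+1).
by rewrite normed_seriesE big_nat_recr//= lerDr sumr_ge0.
Qed.

Lemma ell1_norm0_eq0 x : ell1_norm x = 0 -> x = 0.
Proof.
move=> x0; apply/val_inj/funext => n; apply/eqP; rewrite -normr_le0.
by rewrite -x0 ell1_coord_le.
Qed.

HB.instance Definition _ :=
  Lmodule_isNormed.Build R (ell1 R) ell1_normD ell1_normZ ell1_norm0_eq0.

Lemma ell1_normE x : `|x| = limn [normed series x].
Proof. by []. Qed.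

Lemma ell1_complete (F : set_system (ell1 R)) :
  ProperFilter F -> cauchy F -> cvg F.
Proof.
move=> FF /cauchy_ballP F_cauchy.
have near_dist e : 0 < e -> \forall x & y \near F, `|x - y| < e.
  by move=> e0; have := F_cauchy e e0; rewrite -ball_normE.
have cvg_coord n : cvg ((fun x : ell1 R => x n) @ F).
  apply: R_complete; apply/cauchy_ballP => e e0.
  rewrite near_simpl.
  have := near_dist e e0; apply: filterS => -[x y] /= xy.
  rewrite -ball_normE/=; apply: le_lt_trans xy.
  exact: (ell1_coord_le (x - y) n).
pose u n := lim ((fun x : ell1 R => x n) @ F).
have close (x : ell1 R) e :
    (\forall y \near F, `|x - y| <= e) ->
    forall n, [normed series (val x - u)] n <= e.
  move=> xe n; rewrite normed_seriesE.
  have cx : (fun y : ell1 R => \sum_(0 <= k < n) `|x k - y k|) @ F -->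
      \sum_(0 <= k < n) `|(val x - u) k|.
    apply: cvg_big => [|k _]; first exact: add_continuous.
    apply: cvg_norm; apply: cvgB; first exact: cvg_cst.
    exact: cvg_coord.
  apply: (cvgr_to_le cx); apply: filterS xe => y.
  exact/le_trans/(ell1_norm_ge (x - y) n).
have [x0 x0F] : exists x : ell1 R, \forall y \near F, `|x - y| <= 1.
  have [[P Q] /= [FP FQ] PQ] := near_dist 1 ltr01.
  have [x Px] := filter_ex FP; exists x.
  by apply: filterS FQ => y Qy; apply/ltW/(PQ (x, y)).
have us : u \in abs_summable.
  rewrite (_ : u = val x0 - (val x0 - u)); last by rewrite subKr.
  apply: rpredB; first exact: valP.
  by apply/abs_summableP; exists 1; exact: close.
apply/cvg_ex; exists (Ell1 us); apply/cvgrPdist_le => e e0.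
have [[P Q] /= [FP FQ] PQ] := near_dist e e0.
apply: filterS FP => x Px; rewrite distrC; apply: ell1_norm_le.
apply: close; apply: filterS FQ => y Qy.
by apply/ltW/(PQ (x, y)).
Qed.

HB.instance Definition _ := Uniform_isComplete.Build (ell1 R) ell1_complete.

End Ell1Norm.

Section Dual.
Context {R : realType} (X : normedModType R).

Definition dual_pred : {pred X -> R} :=
  fun f => `[< scalar f /\ continuous f >].

Lemma dual_pred_submod : submod_closed dual_pred.
Proof.
split=> [|a f g /asboolP[lf cf] /asboolP[lg cg]]; apply/asboolP; split.
- by move=> k x y; rewrite /= mulr0 addr0.
- by move=> x; exact: cvg_cst.
- by move=> k x y; rewrite !fctE/= lf lg !scalerDr mulrDr addrACA mulrCA.
- move=> x; apply: cvgD; last exact: cg.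
  by apply: cvgMl_tmp; exact: cf.
Qed.

HB.instance Definition _ :=
  GRing.isSubmodClosed.Build R (X -> R) dual_pred dual_pred_submod.

Record dual := Dual { dual_fun :> X -> R ; _ : dual_fun \in dual_pred }.

HB.instance Definition _ := [isSub for dual_fun].
HB.instance Definition _ := [Choice of dual by <:].
HB.instance Definition _ := [SubChoice_isSubLmodule of dual by <:].

Implicit Types f g : dual.

Lemma dual_scalar f : scalar f.
Proof. by have /asboolP[] := valP f. Qed.

Lemma dual_continuous f : continuous f.
Proof. by have /asboolP[] := valP f. Qed.

HB.instance Definition _ f := GRing.isLinear.Build R X R *%R f (@dual_scalar f).

Definition dual_norm f : R := sup [set `|f x| | x in [set x : X | `|x| <= 1]].

Lemma dual_has_sup f : has_sup [set `|f x| | x in [set x : X | `|x| <= 1]].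
Proof.
split; first by exists `|f 0|, 0; rewrite //= normr0.
have /continuous_linear_bounded/linear_boundedP : {for 0, continuous (f : X -> R^o)}.
  exact: dual_continuous.
move=> /pinfty_ex_gt0[M M0 fM].
exists M => _ [x /= x1 <-].
by rewrite (le_trans (fM x))// ler_piMr// ltW.
Qed.

Lemma dual_norm_ub f x : `|x| <= 1 -> `|f x| <= dual_norm f.
Proof. by move=> x1; apply: sup_upper_bound (dual_has_sup f) _ _; exists x. Qed.

Lemma dual_norm_lub f M :
  (forall x, `|x| <= 1 -> `|f x| <= M) -> dual_norm f <= M.
Proof.
move=> fM; apply: ge_sup; first by case: (dual_has_sup f).
by move=> _ [x /= x1 <-]; exact: fM.
Qed.

Lemma dual_norm_ge0 f : 0 <= dual_norm f.
Proof. by apply: le_trans (dual_norm_ub f (x := 0) _); rewrite ?normr0. Qed.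

Lemma dual_norm_le f x : `|f x| <= dual_norm f * `|x|.
Proof.
have [->|x0] := eqVneq x 0; first by rewrite linear0 !normr0 mulr0.
have nx0 : 0 < `|x| by rewrite normr_gt0.
rewrite -ler_pdivrMr// mulrC -[X in X * _]ger0_norm ?invr_ge0// -normrM.
by rewrite -linearZ/= dual_norm_ub// normfZV.
Qed.

Lemma dual_normD f g : dual_norm (f + g) <= dual_norm f + dual_norm g.
Proof.
apply: dual_norm_lub => x x1.
by rewrite (le_trans (ler_normD _ _))// lerD// dual_norm_ub.
Qed.

Lemma dual_normZ (a : R) f : dual_norm (a *: f) = `|a| * dual_norm f.
Proof.
have le b h : dual_norm (b *: h) <= `|b| * dual_norm h.
  by apply: dual_norm_lub => x x1; rewrite normrM ler_wpM2l// dual_norm_ub.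
have [->|a0] := eqVneq a 0.
  apply/eqP; rewrite eq_le le/= normr0 mul0r; exact: dual_norm_ge0.
apply/eqP; rewrite eq_le le/= -ler_pdivlMl ?normr_gt0//.
by rewrite -normfV (le_trans _ (le _ _))// scalerA mulVf// scale1r.
Qed.

Lemma dual_norm0_eq0 f : dual_norm f = 0 -> f = 0.
Proof.
move=> f0; apply/val_inj/funext => x; apply/eqP; rewrite -normr_le0.
by rewrite (le_trans (dual_norm_le _ _))// f0 mul0r.
Qed.

HB.instance Definition _ :=
  Lmodule_isNormed.Build R dual dual_normD dual_normZ dual_norm0_eq0.

Lemma dual_normE f :
  `|f| = sup [set `|f x| | x in [set x : X | `|x| <= 1]].
Proof. by []. Qed.

End Dual.

Section Bidual.
Context {R : realType} (X : normedModType R).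

Definition eval_at (x : X) (f : dual X) : R := f x.

Lemma eval_at_dual (x : X) : eval_at x \in @dual_pred R (dual X).
Proof.
have lin : scalar (eval_at x) by [].
apply/asboolP; split => //.
pose e : {linear dual X -> R^o} := HB.pack (eval_at x : dual X -> R^o)
  (GRing.isLinear.Build R (dual X) R^o *:%R (eval_at x) lin).
apply: (bounded_linear_continuous (f := e)); apply/linear_boundedP.
near=> M => f; apply: (le_trans (dual_norm_le f x)); rewrite mulrC.
apply: ler_wpM2r; first exact: dual_norm_ge0.
by near: M; apply: nbhs_pinfty_ge; exact: num_real.
Unshelve. all: by end_near. Qed.

Definition bidual_embed (x : X) : dual (dual X) := Dual (eval_at_dual x).

End Bidual.

(** The weak* topology on [dual X] is induced by pointwise convergence on [X]. *)
Definition weak_star {R : realType} (X : normedModType R) : Type :=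
  initial_topology (fun f : dual X => (f : {ptws X -> R})).

HB.instance Definition _ (R : realType) (X : normedModType R) :=
  Topological.on (weak_star X).

Lemma weak_star_cvgP {R : realType} (X : normedModType R)
    (F : set_system (dual X)) (f : dual X) : Filter F ->
  F --> (f : weak_star X) <-> forall x, (fun g : dual X => g x) @ F --> f x.
Proof.
move=> FF; set emb := (fun f : dual X => (f : {ptws X -> R})).
have -> : F --> (f : weak_star X) <-> emb @ F --> emb f.
  split=> h A; first by move=> /= /(@initial_continuous _ _ emb f); exact: h.
  move=> [B [[C oC <-] Cf] BA].
  by apply: filterS BA _; apply: h; apply: open_nbhs_nbhs.
split=> h; first move=> x.
  have := @cvg_comp _ _ _ emb (fun h : {ptws X -> R} => h x) F
    (nbhs (emb f)) (nbhs (f x)) h.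
  by apply; exact: (@proj_continuous _ (fun=> R) x).
apply/cvg_sup => x.
have surj : (fun g : {ptws X -> R} => g x) @` setT = setT.
  by apply/seteqP; split => // y _; exists (cst y).
apply/cvg_image => // A /(h x) FA.
exists ((fun g : {ptws X -> R} => g x) @^-1` A) => //.
by rewrite image_preimage.
Qed.

Section Schur.
Context {R : realType}.
Local Open Scope ereal_scope.

(** The diameter is extended-real valued; the diameter of [set0] is 0. *)
Definition diam {X : normedModType R} (A : set X) : \bar R :=
  ereal_sup (0 |` [set (`|p.1 - p.2|%R)%:E | p in A `*` A]).

Definition clust {X : normedModType R} (x : nat -> X) : set (dual (dual X)) :=
  @cluster (weak_star (dual X)) ((fun k => bidual_embed (x k)) @ \oo).

Definition delta {X : normedModType R} (x : nat -> X) : \bar R :=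
  diam (clust x).

Definition ca {X : normedModType R} (x : nat -> X) : \bar R :=
  ereal_inf (range (fun n => diam [set x k | k in [set k | (n <= k)%N]])).

Definition schur_property (C : {nonneg R}) (X : completeNormedModType R) :=
  forall x : nat -> X, bounded_fun x -> ca x <= C%:num%:E * delta x.

End Schur.

(* Main.v *)
(** Every weak* cluster point of a sequence is approximated, on any given
functional, by arbitrarily late terms, so [delta <= ca] in any space.
Conversely, if [delta x < c < ca x], pick [k_n, l_n >= n] such that
[y_n = x_{k_n} - x_{l_n}] has norm [> c].  Let [z] be the coordinatewise limit
of [y] along a free ultrafilter.  A gliding hump yields [N_0 < N_1 < ...] and
[j_i >= i] such that, up to a small norm, [z] lives on [0, N_0) and [y_{j_i}]
coincides with [z] on [0, N_i) and vanishes beyond [N_{i+1}].  The signs of [z]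
on [0, N_0) and of [y_{j_i}] on [N_i, N_{i+1}) define a norm-one functional
almost norming every [y_{j_i}].  The limits of [x_{k_{j_i}}] and
[x_{l_{j_i}}] along a free ultrafilter are then weak* cluster points at
distance [>= c]. *)

Require Import Defs.
From HB Require Import structures.
From mathcomp Require Import all_boot all_order all_algebra.
From mathcomp Require Import all_classical all_reals all_analysis.
From mathcomp Require Import lra.
Set Implicit Arguments.
Unset Strict Implicit.
Unset Printing Implicit Defensive.

Import Order.TTheory GRing.Theory Num.Theory.
Import numFieldNormedType.Exports.

Local Open Scope classical_set_scope.
Local Open Scope ring_scope.

(** * Ultrafilter limits and weak* cluster points *)

(** Compactness of [[- M, M]] gives a cluster point, and an ultrafilter converges to each of its
    cluster points. *)
Lemma ultra_bounded_cvg (R : realType) (T : Type) (W : set_system T)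
    (u : T -> R) (M : R) :
  UltraFilter W -> (forall t, `|u t| <= M) -> cvg (u @ W).
Proof.
move=> WU uM.
have [p [_ clp]] : `[- M, M]%classic `&` cluster (u @ W) !=set0.
  apply: (@segment_compact R (- M) M).
  by apply: (@filterE _ W) => t /=; rewrite in_itv/= -ler_norml uM.
apply/cvg_ex; exists p => B pB.
have [//|WB] := @in_ultra_setVsetC _ _ (u @^-1` B) WU.
by have [z []] := clp (~` B) B WB pB.
Qed.

Lemma dual_apply_le (R : realType) (X : normedModType R) (f : dual X)
    (x : X) (M : R) : `|x| <= M -> `|f x| <= `|f| * M.
Proof.
move=> xM; apply: le_trans (dual_norm_le f x) _.
by apply: ler_wpM2l => //; exact: dual_norm_ge0.
Qed.

(** A cluster point is the limit of a proper filter containing every tail of the sequence, so each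
    neighbourhood of it meets each tail. *)
Lemma clust_approx (R : realType) (X : normedModType R) (x : nat -> X)
    (F : dual (dual X)) (f : dual X) (n : nat) (e : R) :
  clust x F -> 0 < e -> exists2 k, (n <= k)%N & `|F f - f (x k)| < e.
Proof.
rewrite /clust cluster_cvgE => -[G PG [/weak_star_cvgP GF xG]] e0.
have /cvgrPdist_lt/(_ e e0) Gf := GF f.
have Gn : G [set bidual_embed (x k) | k in [set k | (n <= k)%N]].
  by apply: xG; exists n => // k nk; exists k.
have [H [Hf [k /= nk kH]]] := filter_ex (filterI Gf Gn).
by exists k => //; move: Hf; rewrite /= -kH.
Qed.

(** This plays the part of Banach-Alaoglu: the pointwise limit along [W] is linear and inherits the
    bound [M]. *)
Lemma bidual_ultra_limit (R : realType) (X : normedModType R) (x : nat -> X)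
    (M : R) (W : set_system nat) :
  UltraFilter W -> (forall k, `|x k| <= M) ->
  exists F : dual (dual X), forall f : dual X, f (x k) @[k --> W] --> F f.
Proof.
move=> WU xM.
have fcvg (f : dual X) : cvg (f (x k) @[k --> W]).
  apply: (@ultra_bounded_cvg _ _ _ _ (`|f| * M) WU) => k.
  exact: dual_apply_le.
pose F (f : dual X) : R := lim (f (x k) @[k --> W]).
have lin : scalar F.
  move=> a f g; apply: cvg_lim => //.
  apply: cvgD; last exact: fcvg.
  by apply: cvgMl_tmp; exact: fcvg.
have F_le f : `|F f| <= M * `|f|.
  have cf : `|f (x k)| @[k --> W] --> `|F f| by apply: cvg_norm; exact: fcvg.
  apply: (cvgr_to_le cf); apply: nearW => k.
  by rewrite mulrC dual_apply_le.
suff FP : F \in @dual_pred R (dual X) by exists (Dual FP) => f; exact: fcvg.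
apply/asboolP; split => //.
pose e : {linear dual X -> R^o} := HB.pack (F : dual X -> R^o)
  (GRing.isLinear.Build R (dual X) R^o *:%R F lin).
apply: (bounded_linear_continuous (f := e)); apply/linear_boundedP.
near=> r => f; rewrite (le_trans (F_le f))// ler_wpM2r//.
Unshelve. all: by end_near. Qed.

(** As [W] is free and [i <= s i], the image of [W] under [x \o s] contains all tails of [x]. *)
Lemma clust_ultra_limit (R : realType) (X : normedModType R) (x : nat -> X)
    (s : nat -> nat) (W : set_system nat) (F : dual (dual X)) :
  UltraFilter W -> \oo `<=` W -> (forall i, (i <= s i)%N) ->
  (forall f : dual X, f (x (s i)) @[i --> W] --> F f) -> clust x F.
Proof.
move=> WU ooW sge sF; rewrite /clust cluster_cvgE.
exists ((fun i => bidual_embed (x (s i))) @ W).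
  exact: fmap_proper_filter.
split; first by apply/weak_star_cvgP => f; exact: sF.
move=> A [n _ nA]; apply: ooW; exists n => // i /= ni.
by apply: nA; rewrite /= (leq_trans ni).
Qed.

(** * The inequality valid in every normed space *)

Lemma delta_le_ca (R : realType) (X : normedModType R) (x : nat -> X) :
  (delta x <= ca x)%E.
Proof.
apply: le_ereal_inf_tmp => _ [n _ <-]; apply: ge_ereal_sup => z [->|].
  by apply: ereal_sup_ubound; left.
move=> [[F G] [/= xF xG] <-]; set D := diam _.
have Dkl k l : (n <= k)%N -> (n <= l)%N -> (`|x k - x l|%:E <= D)%E.
  move=> nk nl; apply: ereal_sup_ubound; right.
  by exists (x k, x l) => //; split; [exists k|exists l].
(* The value [+oo] is trivial, and [-oo] contradicts [Dkl n n]. *)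
case: D Dkl => [d||] Dkl; rewrite ?leey//; last first.
  by have := Dkl n n (leqnn n) (leqnn n); rewrite leeNy_eq.
rewrite lee_fin; apply: dual_norm_lub => f f1; apply/ler_addgt0Pr => e e0.
have e2 : 0 < e / 2 by rewrite divr_gt0.
have [k nk Fk] := clust_approx f n xF e2.
have [l nl Gl] := clust_approx f n xG e2.
have fkl : `|f (x k) - f (x l)| <= d.
  rewrite -linearB; have := Dkl _ _ nk nl; rewrite lee_fin => /dual_apply_le.
  move=> /(_ f)/le_trans; apply; rewrite ler_piMl//.
  by have := Dkl n n (leqnn n) (leqnn n); rewrite subrr normr0 lee_fin.
change (`|F f - G f| <= d + e).
move: (F f) (G f) (f (x k)) (f (x l)) Fk Gl fkl => a b a' b'.
have := ler_normB (a - a') (b - b').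
have := ler_normD ((a - a') - (b - b')) (a' - b').
have -> : a - a' - (b - b') + (a' - b') = a - b by lra.
lra.
Qed.

(** * Tails, signs and sign functionals in [ell1] *)

Lemma sum_lt_minn (V : nmodType) (F : nat -> V) (N m : nat) :
  \sum_(0 <= n < m | (n < N)%N) F n = \sum_(0 <= n < minn m N) F n.
Proof.
elim: m => [|m IH]; first by rewrite min0n !big_geq.
rewrite big_mkcond big_nat_recr//= -big_mkcond/= IH; have [mN|Nm] := ltnP m N.
  by rewrite (minn_idPl mN) big_nat_recr.
by rewrite (minn_idPr (leqW Nm)) addr0.
Qed.

Lemma abs_summable_tail (R : realType) (u : nat -> R) (e : R) :
  u \in abs_summable -> 0 < e ->
  exists N, forall m, \sum_(0 <= n < m | (N <= n)%N) `|u n| <= e.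
Proof.
move=> us e0; have cu : cvgn [normed series u] by apply/asboolP.
have /cvgrPdist_le/(_ e e0)[N _ /(_ N (leqnn N))/= Nu] := cu.
exists N => m.
have -> : \sum_(0 <= n < m | (N <= n)%N) `|u n|
    = [normed series u] m - [normed series u] (minn m N).
  rewrite !normed_seriesE -sum_lt_minn.
  rewrite [X in _ = X - _](bigID (fun n => (n < N)%N))/=.
  rewrite addrAC subrr add0r; apply: eq_bigl => n; exact: leqNgt.
have [mN|Nm] := leqP m N; first by rewrite subrr ltW.
rewrite (le_trans _ Nu)// (le_trans _ (ler_norm _))// lerB//.
exact: nondecreasing_cvgn_le (@normed_series_nd _ u) cu m.
Qed.

Lemma norm_sgr_le1 (R : realDomainType) (a : R) : `|Num.sg a| <= 1.
Proof. by rewrite normr_sg; case: eqP; rewrite ?ler01 ?lexx. Qed.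

(** The cost of norming [a] with the sign of a nearby [b]: one [|a - b|] to pass from [|a|] to
    [|b| = sg b * b], another to return to [sg b * a]. *)
Lemma norm_sub_sgr_le (R : realDomainType) (a b : R) :
  `|a| - Num.sg b * a <= 2 * `|a - b|.
Proof.
have : `|Num.sg b * (a - b)| <= `|a - b|.
  by rewrite normrM ler_piMl// norm_sgr_le1.
have := ler_norm (- (Num.sg b * (a - b))); rewrite normrN.
have := ler_normD (a - b) b; rewrite subrK mulrBr -normrEsg.
lra.
Qed.

Lemma norm_sub_contr_le (R : realDomainType) (a s : R) :
  `|s| <= 1 -> `|a| - s * a <= 2 * `|a|.
Proof.
move=> s1; have sa : `|s * a| <= `|a| by rewrite normrM ler_piMl.
by have := ler_norm (- (s * a)); rewrite normrN; lra.
Qed.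

(** The embedding of the unit ball of $\ell_\infty$ into the dual of $\ell_1$; the series converges
    absolutely, being dominated by that of [x]. *)
Lemma ell1_pairing (R : realType) (s : nat -> R) :
  (forall n, `|s n| <= 1) ->
  exists2 phi : dual (ell1 R), `|phi| <= 1 &
    forall x : ell1 R, series (fun n => s n * x n) @ \oo --> phi x.
Proof.
move=> s1; pose t (x : ell1 R) : nat -> R := fun n => s n * x n.
have tle x m : [normed series (t x)] m <= `|x|.
  apply: le_trans (ell1_norm_ge x m); rewrite !normed_seriesE.
  by apply: ler_sum => n _; rewrite normrM ler_piMl.
have tcvg x : cvgn (series (t x)).
  apply: normed_cvg; apply/asboolP; apply/abs_summableP.
  by exists `|x| => m; exact: tle.
pose F x : R := limn (series (t x)).
have lin : scalar F.
  move=> a x y; apply: cvg_lim => //.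
  rewrite (_ : series _ = (fun m => a * series (t x) m + series (t y) m)).
    apply: cvgD; last exact: tcvg.
    by apply: cvgMl_tmp; exact: tcvg.
  apply/funext => m; rewrite /series/= mulr_sumr -big_split/=.
  by apply: eq_bigr => n _; rewrite /t mulrDr mulrCA.
have F_le x : `|F x| <= `|x|.
  have cx : `|series (t x) m| @[m --> \oo] --> `|F x|.
    by apply: cvg_norm; exact: tcvg.
  apply: (cvgr_to_le cx); apply: nearW => m.
  by apply: le_trans (tle x m); exact: ler_norm_sum.
have FP : F \in @dual_pred R (ell1 R).
  apply/asboolP; split => //.
  pose e : {linear ell1 R -> R^o} := HB.pack (F : ell1 R -> R^o)
    (GRing.isLinear.Build R (ell1 R) R^o *:%R F lin).
  apply: (bounded_linear_continuous (f := e)); apply/linear_boundedP.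
  near=> r => x; rewrite (le_trans (F_le x))// ler_peMl//.
exists (Dual FP) => [|x]; last exact: tcvg.
by apply: dual_norm_lub => x x1; exact: le_trans (F_le x) x1.
Unshelve. all: by end_near. Qed.

(** * The gliding hump *)

Lemma gliding_hump (R : realType) (y : nat -> ell1 R) (M eps : R) :
  (forall k, `|y k| <= M) -> 0 < eps ->
  exists (phi : dual (ell1 R)) (j : nat -> nat),
    [/\ `|phi| <= 1, forall i, (i <= j i)%N &
        forall i, `|y (j i)| - eps <= phi (y (j i))].
Proof.
(* Three errors of size [e] will occur, each doubled by the sign estimates. *)
move=> yM eps0; pose e := eps / 6; have e0 : 0 < e by rewrite divr_gt0.
have [W [WU ooW]] := ultraFilterLemma eventually_filter.
pose z n := lim (y k n @[k --> W]).
have zcvg n : y k n @[k --> W] --> z n.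
  apply: (@ultra_bounded_cvg _ _ _ _ M WU) => k.
  exact: le_trans (ell1_coord_le _ _) (yM k).
have zs : z \in abs_summable.
  apply/abs_summableP; exists M => m; rewrite normed_seriesE.
  have cz : \sum_(0 <= n < m) `|y k n| @[k --> W] --> \sum_(0 <= n < m) `|z n|.
    apply: cvg_big => [|n _]; first exact: add_continuous.
    by apply: cvg_norm; exact: zcvg.
  apply: (cvgr_to_le cz); apply: nearW => k.
  exact: le_trans (ell1_norm_ge (y k) m) (yM k).
have [N0 zN0] := abs_summable_tail zs e0.
(* Only finitely many coordinates lie below [N], so some late [y k] is close to [z] there in norm;
   [p.2] then cuts off the tail of that [y k]. *)
have step N : exists p : nat * nat, [/\ (N <= p.1)%N, (N < p.2)%N,
    forall m, \sum_(0 <= n < m | (n < N)%N) `|y p.1 n - z n| <= e &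
    forall m, \sum_(0 <= n < m | (p.2 <= n)%N) `|y p.1 n| <= e].
  have cN : \sum_(0 <= n < N) `|y k n - z n| @[k --> W] --> (0 : R).
    rewrite [X in _ --> X](_ : 0 = \sum_(0 <= n < N) `|z n - z n|); last first.
      by rewrite big1// => n _; rewrite subrr normr0.
    apply: cvg_big => [|n _]; first exact: add_continuous.
    by apply: cvg_norm; apply: cvgB; [exact: zcvg|exact: cvg_cst].
  have WN : W [set k | (N <= k)%N] by apply: ooW; exists N.
  have /cvgr_le/(_ e e0) We := cN.
  have [k [/= ke Nk]] := filter_ex (filterI We WN).
  have [N' yN'] := abs_summable_tail (valP (y k)) e0.
  (* [N.+1] makes the cut points strictly increasing. *)
  exists (k, maxn N.+1 N'); split => //= [|m|m].
  - by rewrite leq_maxl.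
  - rewrite sum_lt_minn (le_trans _ ke)//.
    rewrite [leRHS](@big_cat_nat _ _ _ (minn m N))//= ?geq_minr//.
    by rewrite lerDl sumr_ge0.
  - rewrite (le_trans _ (yN' m))// big_mkcond [leRHS]big_mkcond/=.
    apply: ler_sum => n _; rewrite geq_max.
    by case: ifP => [/andP[_ ->]//|_]; case: ifP.
have [p pP] := choice step.
pose N_ i := iter i (fun N => (p N).2) N0; pose j i := (p (N_ i)).1.
have N_lt i : (N_ i < N_ i.+1)%N by have [] := pP (N_ i).
have N_homo := homo_leq (@leqnn) leq_trans (fun i => ltnW (N_lt i)).
have iN i : (i <= N_ i)%N.
  by elim: i => // i /leq_ltn_trans; apply; exact: N_lt.
(* The blocks [[N_ i, N_ i.+1)] are disjoint and start at [N0], so the sign prescriptions never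
   conflict and a single [s] serves all [i]. *)
have /choice[s sP] n : exists r : R, [/\ `|r| <= 1,
    (n < N0)%N -> r = Num.sg (z n) &
    forall i, (N_ i <= n < N_ i.+1)%N -> r = Num.sg (y (j i) n)].
  have [nN0|N0n] := ltnP n N0.
    exists (Num.sg (z n)); split => [||i /andP[+ _]] //.
      exact: norm_sgr_le1.
    by move/(leq_trans (N_homo 0%N i isT)); rewrite leqNgt nN0.
  have [[i /andP[iln nli]]|ni] := pselect (exists i, (N_ i <= n < N_ i.+1)%N).
    exists (Num.sg (y (j i) n)); split => [||i' /andP[i'n ni']] //.
      exact: norm_sgr_le1.
    suff -> : i' = i by [].
    apply/eqP; rewrite eqn_leq; apply/andP; split; rewrite leqNgt; apply/negP.
      by move=> /N_homo/leq_trans/(_ i'n); rewrite leqNgt nli.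
    by move=> /N_homo/leq_trans/(_ iln); rewrite leqNgt ni'.
  exists 0; split => // [|i ii]; first by rewrite normr0.
  by case: ni; exists i.
have [phi phi1 phiE] := ell1_pairing (fun n => let: And3 h _ _ := sP n in h).
exists phi, j; split => // i.
  by have [/(leq_trans (iN i))] := pP (N_ i).
set a := y (j i).
have [_ _ az aN] := pP (N_ i); rewrite -/(j i) -/a in az aN.
(* Below [N0] the sign of [z] errs by [a - z]; on [[N0, N_ i)], [a] itself is small, being at most
   [|a - z| + |z|]; on the hump the sign is exact; beyond it only the tail of [a] remains. *)
have bound n : `|a n| - s n * a n <=
    2 * ((if (n < N_ i)%N then `|a n - z n| else 0)
    + (if (N0 <= n)%N then `|z n| else 0)
    + (if (N_ i.+1 <= n)%N then `|a n| else 0)).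
  have [s1 sz sy] := sP n.
  have an0 : 0 <= `|a n| := normr_ge0 _.
  have zn0 : 0 <= `|z n| := normr_ge0 _.
  have azn0 : 0 <= `|a n - z n| := normr_ge0 _.
  have [nNi|Nin] := ltnP n (N_ i).
    have [N0n|nN0] := leqP N0 n.
      have := norm_sub_contr_le (a n) s1.
      have := ler_normD (a n - z n) (z n); rewrite subrK.
      by case: ifP => _; lra.
    rewrite sz//; have := norm_sub_sgr_le (a n) (z n).
    by case: ifP => _; lra.
  have [|nNi1] := leqP (N_ i.+1) n.
    have := norm_sub_contr_le (a n) s1.
    by case: ifP => _ *; lra.
  rewrite (sy i) ?Nin ?nNi1// -normrEsg subrr.
  by case: ifP => _; lra.
have total m : [normed series a] m - eps <= series (fun n => s n * a n) m.
  rewrite normed_seriesE /series/= lerBlDr -lerBlDl -sumrB.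
  apply: le_trans (ler_sum _ (fun n _ => bound n)) _.
  rewrite -mulr_sumr !big_split/= -!big_mkcond/=.
  by have := az m; have := zN0 m; have := aN m; rewrite /e; lra.
have acvg : [normed series a] m - eps @[m --> \oo] --> `|a| - eps.
  by apply: cvgB; [exact: (@ell1_cvg _ a)|exact: cvg_cst].
by apply: ler_cvg_to acvg (phiE a) _; exact: nearW.
Qed.

(** * The reverse inequality in [ell1] and the conclusion *)

Lemma ca_le_delta_ell1 (R : realType) (x : nat -> ell1 R) :
  bounded_fun x -> (ca x <= delta x)%E.
Proof.
move=> /pinfty_ex_gt0[M M0 xM']; have xM k : `|x k| <= M by exact: xM'.
have : (0 <= delta x)%E by apply: ereal_sup_ubound; left.
case dE : (delta x) => [d||] // d0; last exact: leey.
apply/lee_addgt0Pr => e e0; rewrite leNgt; apply/negP => dca.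
have far n : exists kl : nat * nat,
    [/\ (n <= kl.1)%N, (n <= kl.2)%N & d + e < `|x kl.1 - x kl.2|].
  have : (d%:E + e%:E < diam [set x k | k in [set k | (n <= k)%N]])%E.
    by apply: lt_le_trans dca _; apply: ereal_inf_lbound; exists n.
  move=> /ereal_sup_gt[_ [->|[_ [[k /= nk <-] [l /= nl <-]] <-]]].
    (* The value 0 adjoined in [diam] cannot exceed [d + e], as [0 <= d]. *)
    by rewrite -EFinD !lte_fin => de; move: d0; rewrite lee_fin; lra.
  by rewrite -EFinD lte_fin => de; exists (k, l).
have [kl klP] := choice far.
pose y n := x (kl n).1 - x (kl n).2.
have yM n : `|y n| <= M + M by rewrite (le_trans (ler_normB _ _))// lerD.
have e2 : 0 < e / 2 by rewrite divr_gt0.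
(* Losing only [e / 2] keeps [phi (y (j i))] above [d + e / 2]. *)
have [phi [j [phi1 jge phiy]]] := gliding_hump yM e2.
(* The same [W] serves both subsequences, so that [phi (y (j i))] tends to [F phi - G phi]. *)
have [W [WU ooW]] := ultraFilterLemma eventually_filter.
have [F FE] := bidual_ultra_limit WU (fun i => xM (kl (j i)).1).
have [G GE] := bidual_ultra_limit WU (fun i => xM (kl (j i)).2).
have Fx : clust x F.
  apply: (clust_ultra_limit (s := fun i => (kl (j i)).1) WU ooW _ FE) => i.
  by have [/(leq_trans (jge i))] := klP (j i).
have Gx : clust x G.
  apply: (clust_ultra_limit (s := fun i => (kl (j i)).2) WU ooW _ GE) => i.
  by have [_ /(leq_trans (jge i))] := klP (j i).
have FGd : `|F - G| <= d.
  rewrite -lee_fin -dE; apply: ereal_sup_ubound; right.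
  by exists (F, G).
have FGphi : `|(F - G) phi| <= d.
  have := dual_apply_le (F - G) phi1; rewrite mulr1 => /le_trans; exact.
have : d + e / 2 <= F phi - G phi.
  apply: (cvgr_to_ge (cvgB (FE phi) (GE phi))); apply: nearW => i.
  have [_ _ klj] := klP (j i); have := phiy i.
  rewrite /y linearB/= => /(le_trans _); apply.
  by lra.
have := le_trans (ler_norm _) FGphi.
change ((F - G) phi) with (F phi - G phi).
lra.
Qed.

Theorem theorem1p3 (R : realType) :
  schur_property 1%:nng (ell1 R) /\
  (forall x : nat -> ell1 R, bounded_fun x -> ca x = delta x).
Proof.
split=> x xb; first by rewrite mul1e ca_le_delta_ell1.
by apply/eqP; rewrite eq_le ca_le_delta_ell1// delta_le_ca.
Qed.
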